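(* Let $G=(V,E,\mu,\kappa)$ be a finite connected undirected graph with at least two vertices, positive vertex masses $\mu$ and positive edge conductances $\kappa$. Let $\lambda_2(G)$ be the Neumann eigenvalue and $H_2(G)$ the two-sided Hardy quantity of $G$. Then $$\frac{1}{4H_2}\le\lambda_2\le\frac{1}{H_2}.$$
   Context: Let $L$ be the Laplacian of $G$ with quadratic form $x^\top Lx=\sum_{(u,v)\in E}\kappa_{(u,v)}(x_u-x_v)^2$ and $M=\mathrm{diag}(\mu)$. The Neumann eigenvalue is $\lambda_2(G)=\min\{\frac{x^\top Lx}{x^\top Mx} : x\in\mathbb{R}^V,\ x^\top M\mathbf{1}=0,\ x\neq 0\}$. For $A\subseteq V$, $\mu(A)=\sum_{v\in A}\mu_v$. For disjoint nonempty $A,B\subseteq V$, the effective resistance $R(A,B)$ is defined by $\frac{1}{R(A,B)}=\min\{x^\top Lx : x|_A=1,\ x|_B=0\}$. The two-sided Hardy quantity is $H_2=\max\{R(A,B)\,(\mu(A)^{-1}+\mu(B)^{-1})^{-1} : A,B\subseteq V \text{ nonempty},\ A\cap B=\emptyset\}$. *)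

(* Defs.v *)
From HB Require Import structures.
From mathcomp Require Import all_boot all_order all_algebra.
From mathcomp Require Import all_classical all_reals.
From mathcomp Require Import topology normedtype derive.
From mathcomp Require Import ring lra.

Set Implicit Arguments.
Unset Strict Implicit.
Unset Printing Implicit Defensive.

Import Order.TTheory GRing.Theory Num.Theory.
Import numFieldNormedType.Exports.

Local Open Scope classical_set_scope.
Local Open Scope ring_scope.

(* Undirected graphs as symmetric relations.  Loops are not excluded; they
   contribute nothing to the Laplacian.  [cond] is only meaningful on edges. *)
Record wgraph (R : realType) (V : finType) := WGraph {
  edge : rel V;
  mass : V -> R;
  cond : V -> V -> R;
  edge_sym : symmetric edge;
  cond_sym : forall u v, cond u v = cond v u;
  mass_gt0 : forall v, 0 < mass v;
  cond_gt0 : forall u v, edge u v -> 0 < cond u v }.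

Section Defs.
Variables (R : realType) (V : finType) (G : wgraph R V).
Implicit Types (x : V -> R) (A B : {set V}).

Definition connected_graph : Prop := forall u v, connect (edge G) u v.

(* x^T L x.  Every undirected edge {u, v} occurs as the two ordered pairs (u, v)
   and (v, u), hence the factor 1/2. *)
Definition energy x : R :=
  2^-1 * \sum_u \sum_(v | edge G u v) cond G u v * (x u - x v) ^+ 2.

(* x^T M y for M = diag(mass). *)
Definition mass_form x (y : V -> R) : R := \sum_v x v * mass G v * y v.

Definition vmass A : R := \sum_(v in A) mass G v.

(* The infimum is a minimum, see [lambda2_min]. *)
Definition lambda2 : R :=
  inf [set energy x / mass_form x x | x in
        [set x : V -> R | mass_form x (fun=> 1) = 0 /\ x <> (fun=> 0)]].

(* The infimum is a minimum, see [eff_cond_min]. *)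
Definition eff_cond A B : R :=
  inf [set energy x | x in
        [set x : V -> R | (forall v, v \in A -> x v = 1) /\
                          (forall v, v \in B -> x v = 0)]].

Definition eff_res A B : R := (eff_cond A B)^-1.

(* All the values are nonnegative, so the default value 0 is immaterial as soon
   as V has two vertices, see [hardy2_max]. *)
Definition hardy2 : R :=
  \big[Num.max/0]_(AB : {set V} * {set V} |
      [&& AB.1 != finset.set0, AB.2 != finset.set0 &
          (AB.1 :&: AB.2 == finset.set0)%SET])
    (eff_res AB.1 AB.2 * ((vmass AB.1)^-1 + (vmass AB.2)^-1)^-1).


Definition laplacian (u v : V) : R :=
  (\sum_(w | edge G u w) cond G u w) *+ (u == v)
    - (if edge G u v then cond G u v else 0).

Lemma energy_laplacian x :
  energy x = \sum_u \sum_v x u * laplacian u v * x v.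
Proof.
pose k u v : R := if edge G u v then cond G u v else 0.
have kC u v : k u v = k v u by rewrite /k edge_sym cond_sym.
have kE u (F : V -> R) :
    \sum_(v | edge G u v) cond G u v * F v = \sum_v k u v * F v.
  by rewrite big_mkcond; apply: eq_bigr => v _; rewrite /k; case: ifP; rewrite ?mul0r.
have dE u : \sum_(w | edge G u w) cond G u w = \sum_w k u w.
  by rewrite big_mkcond.
rewrite /energy; under eq_bigr do rewrite kE.
set D := \sum_u (\sum_v k u v) * x u ^+ 2.
set S := \sum_u \sum_v k u v * (x u * x v).
have -> : \sum_u \sum_v k u v * (x u - x v) ^+ 2 = D + D - S *+ 2.
  have D1 : D = \sum_u \sum_v k u v * x u ^+ 2.
    by apply: eq_bigr => u _; rewrite mulr_suml.
  have D2 : D = \sum_u \sum_v k u v * x v ^+ 2.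
    rewrite D1 exchange_big; apply: eq_bigr => u _.
    by apply: eq_bigr => v _; rewrite kC.
  rewrite {1}D1 D2 /S mulr2n opprD -!sumrN -!big_split.
  apply: eq_bigr => u _ /=; rewrite -!sumrN -!big_split.
  by apply: eq_bigr => v _ /=; ring.
have -> : \sum_u \sum_v x u * laplacian u v * x v = D - S.
  rewrite /D /S -sumrN -big_split; apply: eq_bigr => u _ /=.
  transitivity (\sum_v ((\sum_w k u w) * (x u * x v)) *+ (u == v)
                - \sum_v k u v * (x u * x v)).
    rewrite -sumrN -big_split; apply: eq_bigr => v _ /=.
    by rewrite /laplacian dE -/(k u v); case: (u == v); rewrite ?mulr1n ?mulr0n; ring.
  congr (_ - _); rewrite (bigD1 u)//= eqxx mulr1n -expr2 [X in _ + X]big1 ?addr0 //.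
  by move=> v /negbTE; rewrite eq_sym => ->.
by field.
Qed.

Lemma energy_ge0 x : 0 <= energy x.
Proof.
apply: mulr_ge0; first by rewrite invr_ge0.
apply: sumr_ge0 => u _; apply: sumr_ge0 => v uv.
by rewrite mulr_ge0 ?sqr_ge0// ltW// cond_gt0.
Qed.

Lemma energyZ c x : energy (fun v => c * x v) = c ^+ 2 * energy x.
Proof.
rewrite /energy mulrCA; congr (_ * _); rewrite mulr_sumr.
apply: eq_bigr => u _; rewrite mulr_sumr; apply: eq_bigr => v _; ring.
Qed.

Lemma energy_eq0 x : connected_graph -> energy x = 0 -> forall u v, x u = x v.
Proof.
move=> cG /eqP; rewrite mulf_eq0 invr_eq0 pnatr_eq0/= psumr_eq0; last first.
  move=> u _; apply: sumr_ge0 => v uv.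
  by rewrite mulr_ge0 ?sqr_ge0// ltW// cond_gt0.
move=> /allP x0.
have step u v : edge G u v -> x u = x v.
  move=> uv; have /= := x0 u (mem_index_enum _).
  rewrite psumr_eq0; last first.
    by move=> w uw; rewrite mulr_ge0 ?sqr_ge0// ltW// cond_gt0.
  move=> /allP/(_ v (mem_index_enum _)); rewrite uv/= mulf_eq0.
  by rewrite gt_eqF ?cond_gt0//= sqrf_eq0 subr_eq0 => /eqP.
move=> u v; have /connectP[p] := cG u v.
elim: p u => [|w p IH] u /=; first by move=> _ ->.
by move=> /andP[/step -> wp] vE; exact: IH.
Qed.

Let coord_continuous v : continuous (fun x : {ptws V -> R} => x v).
Proof. exact: (@proj_continuous V (fun=> R : topologicalType) v). Qed.

Let continuousM (T : topologicalType) (f g : T -> R) :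
  continuous f -> continuous g -> continuous (fun t => f t * g t).
Proof. by move=> cf cg t; exact: (@cvgM _ _ _ _ f g _ _ (cf t) (cg t)). Qed.

Let continuousB (T : topologicalType) (f g : T -> R) :
  continuous f -> continuous g -> continuous (fun t => f t - g t).
Proof. by move=> cf cg t; exact: (@cvgB _ _ _ _ _ f g _ _ (cf t) (cg t)). Qed.

Let continuous_sum (T : topologicalType) (P : pred V) (F : V -> T -> R) :
  (forall v, P v -> continuous (F v)) ->
  continuous (fun t => \sum_(v | P v) F v t).
Proof.
move=> cF; apply: continuous_big => //.
exact: (@pseudometric_normed_Zmodule.add_continuous R R).
Qed.

Lemma energy_continuous : continuous (energy : {ptws V -> R} -> R).
Proof.
apply: (@continuousM {ptws V -> R} (fun=> 2^-1)
  (fun x => \sum_u \sum_(v | edge G u v) cond G u v * (x u - x v) ^+ 2)).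
  exact: cst_continuous.
apply: continuous_sum => u _; apply: continuous_sum => v _.
apply: (@continuousM _ (fun=> cond G u v)); first exact: cst_continuous.
have h := @continuousB {ptws V -> R} _ _ (@coord_continuous u) (@coord_continuous v).
exact: (@continuousM {ptws V -> R} _ _ h h).
Qed.

Let mass1_continuous : continuous (fun x : {ptws V -> R} => mass_form x (fun=> 1)).
Proof.
apply: (@continuous_sum {ptws V -> R} xpredT (fun v x => x v * mass G v * 1)) => v _.
do 2!(apply: continuousM; last exact: cst_continuous).
exact: coord_continuous.
Qed.

Let mass2_continuous : continuous (fun x : {ptws V -> R} => mass_form x x).
Proof.
apply: (@continuous_sum {ptws V -> R} xpredT (fun v x => x v * mass G v * x v)) => v _.
apply: (@continuousM {ptws V -> R} (fun x => x v * mass G v) (fun x => x v)).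
  apply: continuousM; last exact: cst_continuous.
  exact: coord_continuous.
exact: coord_continuous.
Qed.

Let inf_min (S : set R) m : S m -> lbound S m -> inf S = m.
Proof.
move=> Sm lSm; apply/eqP; rewrite eq_le; apply/andP; split.
  by apply: ge_inf => //; exists m.
by apply: lb_le_inf => //; exists m.
Qed.

Lemma eff_cond_min A B : (A :&: B)%SET = finset.set0 ->
  exists x, [/\ forall v, v \in A -> x v = 1, forall v, v \in B -> x v = 0,
    eff_cond A B = energy x &
    forall y, (forall v, v \in A -> y v = 1) -> (forall v, v \in B -> y v = 0) ->
      energy x <= energy y].
Proof.
move=> /eqP; rewrite setI_eq0 => dAB.
pose a v : R := if v \in A then 1 else 0.
pose b v : R := if v \in B then 0 else 1.
pose K := [set f : {ptws V -> R} | forall v, `[a v, b v]%classic (f v)].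
have cK : compact K.
  exact: (@tychonoff V (fun=> R : topologicalType) (fun v => `[a v, b v]%classic)
    (fun v => @segment_compact R (a v) (b v))).
have ab v : a v <= b v.
  rewrite /a /b; case: ifP => [vA|_]; last by case: ifP.
  by rewrite (disjointFr dAB).
have K0 : K !=set0 by exists a => v /=; rewrite in_itv /= lexx ab.
have [x] := compact_EVT_min K0 cK (continuous_subspaceT energy_continuous).
rewrite inE => Kx xmin.
have KA f : K f -> forall v, v \in A -> f v = 1.
  move=> Kf v vA; have := Kf v; rewrite /= in_itv /= /a /b vA (disjointFr dAB vA).
  by move=> /andP[? ?]; apply/eqP; rewrite eq_le; apply/andP.
have KB f : K f -> forall v, v \in B -> f v = 0.
  move=> Kf v vB; have := Kf v; rewrite /= in_itv /= /a /b vB (disjointFl dAB vB).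
  by move=> /andP[? ?]; apply/eqP; rewrite eq_le; apply/andP.
have min_x y : (forall v, v \in A -> y v = 1) -> (forall v, v \in B -> y v = 0) ->
    energy x <= energy y.
  move=> yA yB; pose c (t : R) := Num.max 0 (Num.min 1 t).
  apply: (@le_trans _ _ (energy (c \o y))).
    apply: xmin; rewrite inE => v /=; rewrite in_itv /= /a /b.
    case: ifPn => vA; case: ifPn => vB.
    - by move: vB; rewrite (disjointFr dAB vA).
    - by rewrite yA// /c minxx (max_r ler01) lexx.
    - by rewrite yB// /c (min_r ler01) maxxx lexx.
    - by rewrite /c le_max lexx/= ge_max ler01 ge_min lexx.
  apply: ler_wpM2l; first by rewrite invr_ge0.
  apply: ler_sum => u _; apply: ler_sum => v uv /=.
  apply: ler_wpM2l; first by rewrite ltW// cond_gt0.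
  have cle s t : s <= t -> 0 <= c t - c s <= t - s.
    rewrite /c; have [h1|h1] := leP 1 s; have [h2|h2] := leP 1 t;
      rewrite ?(max_r ler01); case: (leP 0 s) => ?; case: (leP 0 t) => ?;
      move=> ?; apply/andP; lra.
  have [/cle/andP[]|/ltW/cle/andP[]] := leP (y u) (y v); nra.
exists x; split => //; [exact: KA|exact: KB|].
apply: inf_min; first by exists x => //; split; [exact: KA|exact: KB].
by move=> _ [y [yA yB]] <-; exact: min_x.
Qed.

Lemma eff_cond_gt0 A B : connected_graph ->
  A != finset.set0 -> B != finset.set0 -> (A :&: B)%SET = finset.set0 ->
  0 < eff_cond A B.
Proof.
move=> cG /set0Pn[u uA] /set0Pn[v vB] /eff_cond_min[x [xA xB -> _]].
rewrite lt_neqAle energy_ge0 andbT eq_sym; apply/negP => /eqP.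
by move=> /(energy_eq0 cG)/(_ u v)/eqP; rewrite xA// xB// oner_eq0.
Qed.

Lemma mass_form_gt0 x : x <> (fun=> 0) -> 0 < mass_form x x.
Proof.
move=> x0; have ge0 v : 0 <= x v * mass G v * x v.
  by rewrite mulrAC -expr2 mulr_ge0 ?sqr_ge0// ltW// mass_gt0.
rewrite lt_neqAle sumr_ge0// andbT eq_sym; apply/negP.
rewrite psumr_eq0// => /allP h; apply: x0; apply/funext => v.
have := h v (mem_index_enum _).
rewrite /= mulrAC -expr2 mulf_eq0 [mass G v == 0]gt_eqF ?mass_gt0// orbF.
by rewrite sqrf_eq0 => /eqP.
Qed.

Lemma mass_formZ c d x y :
  mass_form (fun v => c * x v) (fun v => d * y v) = c * d * mass_form x y.
Proof. by rewrite /mass_form mulr_sumr; apply: eq_bigr => v _; ring. Qed.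

Lemma lambda2_min : (1 < #|V|)%N ->
  exists x, [/\ mass_form x (fun=> 1) = 0, x <> (fun=> 0),
    lambda2 = energy x / mass_form x x &
    forall y, mass_form y (fun=> 1) = 0 -> y <> (fun=> 0) ->
      energy x / mass_form x x <= energy y / mass_form y y].
Proof.
move=> V2.
have nrm y : mass_form y (fun=> 1) = 0 -> y <> (fun=> 0) ->
    exists z, [/\ mass_form z (fun=> 1) = 0, mass_form z z = 1 &
                  energy z = energy y / mass_form y y].
  move=> y0 /mass_form_gt0 yy; pose c := (Num.sqrt (mass_form y y))^-1.
  have c2 : c ^+ 2 = (mass_form y y)^-1 by rewrite exprVn sqr_sqrtr// ltW.
  exists (fun v => c * y v); split.
  - have -> : (fun _ : V => 1 : R) = (fun=> 1 * 1) by rewrite mulr1.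
    by rewrite (mass_formZ c 1 y (fun=> 1)) y0 mulr0.
  - by rewrite mass_formZ -expr2 c2 mulVf ?gt_eqF.
  - by rewrite energyZ c2 mulrC.
pose b v : R := 1 + (mass G v)^-1.
pose C := [set f : {ptws V -> R} | forall v, `[- b v, b v]%classic (f v)].
have cC : compact C.
  exact: (@tychonoff V (fun=> R : topologicalType) (fun v => `[- b v, b v]%classic)
    (fun v => @segment_compact R (- b v) (b v))).
pose K : set {ptws V -> R} :=
  [set f | mass_form f (fun=> 1) = 0] `&` [set f | mass_form f f = 1].
have KC : K `<=` C.
  move=> f [_ /= f1] v; rewrite /= in_itv /= -ler_norml.
  have m0 := mass_gt0 G v; have im0 : 0 < (mass G v)^-1 by rewrite invr_gt0.
  have fm : f v ^+ 2 <= (mass G v)^-1.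
    rewrite -[leRHS]mul1r ler_pdivlMr// -f1 /mass_form (bigD1 v)//=.
    rewrite [f v * _ * f v]mulrAC -expr2 lerDl; apply: sumr_ge0 => w _.
    by rewrite mulrAC -expr2 mulr_ge0 ?sqr_ge0// ltW// mass_gt0.
  have b0 : 0 <= b v by rewrite /b; lra.
  rewrite -[leRHS]ger0_norm// -ler_sqr ?nnegrE// !real_normK ?num_real//.
  by apply: (le_trans fm); rewrite /b; nra.
have cK : compact K.
  apply: (subclosed_compact _ cC KC); apply: closedI.
    by apply: (@preimage_closed _ _ _ [set t : R | t = 0]) => [f _|];
      [exact: mass1_continuous|exact: closed_eq].
  by apply: (@preimage_closed _ _ _ [set t : R | t = 1]) => [f _|];
      [exact: mass2_continuous|exact: closed_eq].
have K0 : K !=set0.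
  have [p [q [_ _ pq]]] := card_gt1P V2.
  pose y v : R := (mass G v)^-1 * ((v == p)%:R - (v == q)%:R).
  have [||z [z0 z1 _]] := nrm y; last by exists z.
    rewrite /mass_form; transitivity (\sum_v ((v == p)%:R - (v == q)%:R) : R).
      apply: eq_bigr => v _; rewrite /y mulr1 mulrAC mulVf ?mul1r//.
      by rewrite gt_eqF ?mass_gt0.
    rewrite sumrB (bigD1 p)//= eqxx big1 => [|v /negbTE -> //].
    by rewrite (bigD1 q)//= eqxx big1 ?subrr// => v /negbTE ->.
  move=> /(congr1 (@^~ p)); rewrite /y eqxx (negbTE pq) subr0 mulr1 => /eqP.
  by rewrite invr_eq0 gt_eqF ?mass_gt0.
have [x] := compact_EVT_min K0 cK (continuous_subspaceT energy_continuous).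
rewrite inE => -[/= x0 x1] xmin.
have xn0 : x <> (fun=> 0).
  move=> xE; move/eqP: x1; rewrite xE /mass_form big1 => [|v _].
    by rewrite eq_sym oner_eq0.
  by rewrite mulr0.
have min_x y : mass_form y (fun=> 1) = 0 -> y <> (fun=> 0) ->
    energy x / mass_form x x <= energy y / mass_form y y.
  move=> y0 yn0; have [z [z0 z1 <-]] := nrm y y0 yn0.
  by rewrite x1 divr1; apply: xmin; rewrite inE.
exists x; split => //; apply: inf_min; first by exists x.
by move=> _ [y [y0 yn0]] <-; exact: min_x.
Qed.

Lemma hardy2_max : (1 < #|V|)%N ->
  (exists A B, [/\ A != finset.set0, B != finset.set0, (A :&: B)%SET = finset.set0 &
     hardy2 = eff_res A B * ((vmass A)^-1 + (vmass B)^-1)^-1]) /\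
  (forall A B, A != finset.set0 -> B != finset.set0 -> (A :&: B)%SET = finset.set0 ->
     eff_res A B * ((vmass A)^-1 + (vmass B)^-1)^-1 <= hardy2).
Proof.
move=> V2; split; last first.
  by move=> A B A0 B0 dAB; apply: (bigmax_sup (A, B)) => //=; rewrite A0 B0 dAB eqxx.
have [p [q [_ _ pq]]] := card_gt1P V2.
pose P (AB : {set V} * {set V}) :=
  [&& AB.1 != finset.set0, AB.2 != finset.set0 &
          (AB.1 :&: AB.2 == finset.set0)%SET].
pose F (AB : {set V} * {set V}) : R :=
  eff_res AB.1 AB.2 * ((vmass AB.1)^-1 + (vmass AB.2)^-1)^-1.
have P0 : P ([set p]%SET, [set q]%SET).
  rewrite /P /= -!card_gt0 !cards1 setI_eq0 disjoints1 inE.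
  by rewrite pq.
have vmass_ge0 A : 0 <= vmass A by apply: sumr_ge0 => v _; rewrite ltW ?mass_gt0.
have F0 AB : P AB -> 0 <= F AB.
  case: AB => A B /and3P[/= _ _ /eqP dAB]; rewrite /F /= mulr_ge0//.
    by rewrite invr_ge0; have [x [_ _ -> _]] := eff_cond_min dAB; exact: energy_ge0.
  by rewrite invr_ge0 addr_ge0// invr_ge0.
have [[A B] /and3P[/= A0 B0 /eqP dAB] E] := 
  eq_bigmax (x := 0) ([set p]%SET, [set q]%SET) P F P0 F0.
by exists A, B.
Qed.

End Defs.

(* Main.v *)
Require Import Defs.
From mathcomp Require Import all_boot all_order all_algebra.
From mathcomp Require Import all_classical all_reals.
From mathcomp Require Import ring lra.

Local Open Scope ring_scope.

Set Implicit Arguments.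
Unset Strict Implicit.
Unset Printing Implicit Defensive.

Import Order.TTheory GRing.Theory Num.Theory.

(* Upper bound: the equilibrium potential of an optimal pair (A, B), centred, is
   a test function for lambda2, and a (1 + d)^2 + b d^2 >= (1/a + 1/b)^-1.

   Lower bound: let x be an eigenfunction for lambda2.  The flux of its gradient
   through the level s > 0 is lambda2 U(s) with U(s) the sum of mass * x over
   {x > s}.  Subdividing the edges at the levels of x and shorting each level
   gives a path, so that the resistance between {x <= 0} and {x >= t} is at least
   r(t) / lambda2 with r(t) the integral of 1/U over [0, t].  A Hardy inequality
   on the half-line yields t with r(t) mass{x >= t} >= 1/4; call that set A.  The
   same for -x gives B, and the resistances on the two sides of the zero level
   add up: R(A, B) >= (1/mass A + 1/mass B) / (4 lambda2). *)

(** * Elementary inequalities and summation by parts *)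

(** At [e = - b / k] with [k > c] the expression is negative unless [b = 0]. This serves as the
    first-order condition at a minimum. *)
Lemma quadratic_ge0_linear0 (R : realType) (b c : R) :
  (forall e, 0 <= e * b + e ^+ 2 * c) -> b = 0.
Proof.
move=> h; pose k := `|c| + 1.
have k0 : 0 < k by rewrite /k ltr_pwDr.
have ck : c <= k - 1 by rewrite /k addrK ler_norm.
have := h (- b / k).
have -> : - b / k * b + (- b / k) ^+ 2 * c = (b / k) ^+ 2 * (c - k).
  by field; rewrite gt_eqF.
move=> h1; have bk : (b / k) ^+ 2 = 0 by have := sqr_ge0 (b / k); nra.
by move/eqP: bk; rewrite sqrf_eq0 mulf_eq0 invr_eq0 (gt_eqF k0) orbF => /eqP.
Qed.

(** Lagrange's identity: twice the difference of the two sides is the double sum of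
    [a i * a j * (t i - t j) ^+ 2]. *)
Lemma cauchy_schwarz_weighted (R : realType) (I : finType) (a t : I -> R) :
  (forall i, 0 <= a i) ->
  (\sum_i a i * t i) ^+ 2 <= (\sum_i a i) * (\sum_i a i * t i ^+ 2).
Proof.
move=> a0; set A := \sum_i a i; set B := \sum_i _; set C := \sum_i _.
have : 0 <= \sum_i \sum_j a i * a j * (t i - t j) ^+ 2.
  by apply: sumr_ge0 => i _; apply: sumr_ge0 => j _; rewrite mulr_ge0 ?sqr_ge0 // mulr_ge0.
have -> : \sum_i \sum_j a i * a j * (t i - t j) ^+ 2 = 2 * (A * C - B ^+ 2).
  transitivity (\sum_i (a i * t i ^+ 2 * A - 2 * (a i * t i) * B + a i * C)).
    apply: eq_bigr => i _; rewrite !mulr_sumr -sumrN -!big_split /=.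
    by apply: eq_bigr => j _; ring.
  rewrite !big_split /= sumrN -!mulr_suml -mulr_sumr -/A -/B -/C; ring.
lra.
Qed.

(** Both sides sum [a j * d l] over the triangle [l <= j < p]. *)
Lemma exchange_partial_sums (R : realType) (p : nat) (a d : nat -> R) :
  \sum_(0 <= j < p) a j * (\sum_(0 <= l < j.+1) d l) =
  \sum_(0 <= l < p) d l * (\sum_(l <= j < p) a j).
Proof.
elim: p => [|p IH]; first by rewrite !big_geq.
rewrite big_nat_recr //= IH [RHS]big_nat_recr //= big_nat1.
rewrite big_nat_recr //= mulrDr [d p * _]mulrC addrA; congr (_ + _).
rewrite mulr_sumr -big_split /=; apply: eq_big_nat => l /andP[_ lp].
by rewrite [in RHS]big_nat_recr /= ?(ltnW lp) // mulrDr [d l * a p]mulrC.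
Qed.

(** * A discrete Hardy inequality on the half-line *)

Section HardyLine.
Variables (R : realType) (p : nat) (X m : nat -> R).
Hypothesis p_gt0 : (0 < p)%N.
Hypothesis X0_gt0 : 0 < X 0%N.
Hypothesis X_incr : forall i, (i.+1 < p)%N -> X i <= X i.+1.
Hypothesis m_gt0 : forall i, 0 < m i.

Definition gap i := X i - (if i is k.+1 then X k else 0).
(** The constant value of U on the levels from [X (i - 1)] (0 if [i = 0]) to [X i]; [line_res i] is
    then the integral of 1/U over [0, [X i]]. *)
Definition moment i := \sum_(i <= j < p) m j * X j.
Definition line_res i := \sum_(0 <= l < i.+1) gap l / moment l.

Lemma sum_gap j : \sum_(0 <= l < j.+1) gap l = X j.
Proof.
elim: j => [|j IH]; first by rewrite big_nat1 /gap subr0.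
by rewrite big_nat_recr //= IH /gap; ring.
Qed.

Lemma gap_ge0 i : (i < p)%N -> 0 <= gap i.
Proof.
case: i => [|i] ip; first by rewrite /gap subr0 ltW.
by rewrite /gap subr_ge0 X_incr.
Qed.

Lemma X_gt0 i : (i < p)%N -> 0 < X i.
Proof.
elim: i => [//|i IH] ip; exact: lt_le_trans (IH (ltnW ip)) (X_incr ip).
Qed.

Lemma moment_gt0 i : (i < p)%N -> 0 < moment i.
Proof.
move=> ip; rewrite /moment big_ltn // ltr_pwDl ?mulr_gt0 ?X_gt0 //.
rewrite big_nat_cond sumr_ge0 // => j /andP[/andP[_ jp] _].
by rewrite mulr_ge0 ?ltW ?X_gt0.
Qed.

Lemma gap_div_moment_ge0 i : (i < p)%N -> 0 <= gap i / moment i.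
Proof. by move=> ip; rewrite divr_ge0 ?gap_ge0 // ltW // moment_gt0. Qed.

Lemma line_res_gt0 i : (i < p)%N -> 0 < line_res i.
Proof.
elim: i => [|i IH] ip.
  by rewrite /line_res big_nat1 divr_gt0 ?moment_gt0 // /gap subr0.
rewrite /line_res big_nat_recr //= -/(line_res i).
by rewrite ltr_pwDl ?gap_div_moment_ge0 // IH // ltnW.
Qed.

(* Test the moments against the square root of the resistance and sum by parts
   in both orders: on one side the increment of [sqrt r] is at least
   [dr / (2 sqrt r)], on the other [N r < 1/4] bounds the tails. *)
Lemma hardy_line :
  exists2 i, (i < p)%N & 4^-1 <= line_res i * \sum_(i <= j < p) m j.
Proof.
apply: contrapT => nex.
have small i : (i < p)%N -> line_res i * \sum_(i <= j < p) m j < 4^-1.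
  by move=> ip; rewrite ltNge; apply/negP => h; apply: nex; exists i.
pose s i := Num.sqrt (line_res i).
have s_gt0 i : (i < p)%N -> 0 < s i by move=> ip; rewrite sqrtr_gt0 line_res_gt0.
have sE i : (i < p)%N -> s i ^+ 2 = line_res i.
  by move=> ip; rewrite sqr_sqrtr // ltW // line_res_gt0.
have s_le i : (i.+1 < p)%N -> s i <= s i.+1.
  move=> ip; rewrite ler_wsqrtr // /line_res [leRHS]big_nat_recr //=.
  by rewrite lerDl gap_div_moment_ge0.
pose ds i := s i - (if i is k.+1 then s k else 0).
have dsE j : \sum_(0 <= l < j.+1) ds l = s j.
  elim: j => [|j IH]; first by rewrite big_nat1 /ds subr0.
  by rewrite big_nat_recr //= IH /ds; ring.
(* The increment [gap i / moment i] of the resistance is a difference of squares of consecutive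
   values of [s], hence at most [2 * s i * ds i]. *)
have lower i : (i < p)%N -> gap i / (2 * s i) <= ds i * moment i.
  move=> ip; have si := s_gt0 _ ip; have Ui := moment_gt0 ip.
  suff h : gap i / moment i <= ds i * (2 * s i).
    rewrite ler_pdivrMr; last by lra.
    by rewrite ler_pdivrMr // in h; rewrite mulrAC.
  case: i ip si Ui => [|i] ip si Ui.
    have := sE _ ip; rewrite {1}/line_res big_nat1 => <-; rewrite /ds subr0; nra.
  have := sE _ ip; rewrite {1}/line_res big_nat_recr //= -/(line_res i).
  rewrite -(sE _ (ltnW ip)) => E.
  have := s_le _ ip; have := s_gt0 _ (ltnW ip); rewrite /ds; nra.
have smallV i : (i < p)%N -> \sum_(i <= j < p) m j * s i < 4^-1 / s i.
  move=> ip; have si := s_gt0 _ ip; rewrite -mulr_suml ltr_pdivlMr //.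
  by have := small _ ip; rewrite -(sE _ ip) mulrC expr2 mulrA.
(* By parts, the sum consists of tails of [m] times increments of [s]. Each tail is below
   [4^-1 / s ^+ 2], and [(b - a) / b ^+ 2 <= 1 / a - 1 / b] makes the bounds telescope. *)
have tail k i : (i + k.+1)%N = p ->
    \sum_(i <= j < p) m j * s j <= \sum_(i <= j < p) m j * s i + 4^-1 / s i.
  elim: k i => [|k IH] i ikp.
    have ip : (i < p)%N by rewrite -ikp addn1.
    have pE : p = i.+1 by rewrite -ikp addn1.
    by rewrite [in leLHS]pE [in leRHS]pE !big_nat1 lerDl divr_ge0 ?invr_ge0 ?sqrtr_ge0.
  have ip : (i.+1 < p)%N by rewrite -ikp !addnS !ltnS leq_addr.
  have ip' := ltnW ip.
  have := IH i.+1; rewrite addSnnS => /(_ ikp) {}IH.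
  rewrite !(big_ltn ip') -addrA lerD2l (le_trans IH) //.
  rewrite -!mulr_suml; have := smallV _ ip; rewrite -mulr_suml.
  set N := \sum_(_ <= _ < _) _; set a := s i; set b := s i.+1 => h.
  have a0 : 0 < a by exact: s_gt0.
  have b0 : 0 < b by exact: s_gt0.
  have ab : a <= b by exact: s_le.
  have N1 : N * (b - a) <= 4^-1 / b / b * (b - a).
    by rewrite ler_wpM2r ?subr_ge0 // ler_pdivlMr // ltW.
  suff : 4^-1 / b / b * (b - a) <= 4^-1 / a - 4^-1 / b by lra.
  have -> : 4^-1 / a - 4^-1 / b = 4^-1 / b / a * (b - a).
    by field; rewrite !gt_eqF.
  rewrite ler_wpM2r ?subr_ge0 // ler_wpM2l ?divr_ge0 ?invr_ge0 ?(ltW b0) //.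
  by rewrite lef_pV2 ?posrE.
have upper i : (i < p)%N -> \sum_(i <= j < p) m j * s j < (2 * s i)^-1.
  move=> ip; apply: le_lt_trans (tail (p - i.+1)%N i _) _.
    by rewrite -addSnnS subnKC.
  have := smallV _ ip; have si := s_gt0 _ ip.
  have -> : (2 * s i)^-1 = 4^-1 / s i + 4^-1 / s i by field; rewrite gt_eqF.
  lra.
have E1 : \sum_(0 <= j < p) m j * X j * s j = \sum_(0 <= l < p) ds l * moment l.
  rewrite -exchange_partial_sums; apply: eq_bigr => j _.
  by rewrite dsE.
have E2 : \sum_(0 <= j < p) m j * X j * s j =
    \sum_(0 <= l < p) gap l * \sum_(l <= j < p) m j * s j.
  rewrite -exchange_partial_sums; apply: eq_bigr => j _.
  by rewrite sum_gap mulrAC.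
(* Strictness comes from the term [l = 0]; later gaps may vanish. *)
have : \sum_(0 <= l < p) gap l * (\sum_(l <= j < p) m j * s j) <
       \sum_(0 <= l < p) gap l / (2 * s l).
  rewrite [ltLHS](big_ltn p_gt0) [ltRHS](big_ltn p_gt0) ltr_leD //.
    have g0 : 0 < gap 0 by rewrite /gap subr0.
    by rewrite (ltr_pM2l g0); exact: upper.
  by apply: ler_sum_nat => l /andP[_ lp]; apply: ler_wpM2l; [exact: gap_ge0|exact/ltW/upper].
rewrite -E2 E1 ltNge => /negP; apply.
by apply: ler_sum_nat => l /andP[_ lp]; exact: lower.
Qed.

End HardyLine.

Lemma sum_set_drop (R : realType) (V : finType) (v0 : V) (s : seq V) i
    (F : V -> R) : uniq s ->
  \sum_(v in [set v in drop i s]) F v = \sum_(i <= j < size s) F (nth v0 s j).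
Proof.
move=> us; rewrite (eq_bigl (fun v => v \in drop i s)); last first.
  by move=> v; rewrite inE.
rewrite -big_uniq ?drop_uniq //= (big_nth v0) size_drop.
rewrite -[in RHS](add0n i) big_addn; apply: eq_bigr => j _.
by rewrite nth_drop addnC.
Qed.

(** * Bilinear forms and the eigenfunction for [lambda2] *)

Section Graph.
Variables (R : realType) (V : finType) (G : wgraph R V).
Implicit Types (x y z : V -> R).

(** The polarised form x^T L z. *)
Definition energy_form x z : R :=
  2^-1 * \sum_u \sum_(v | edge G u v)
           cond G u v * ((x u - x v) * (z u - z v)).

Lemma energyD x z e : energy G (fun v => x v + e * z v) =
  energy G x + 2 * e * energy_form x z + e ^+ 2 * energy G z.
Proof.
rewrite /energy /energy_form mulrCA [e ^+ 2 * _]mulrCA -!mulrDr.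
congr (_ * _); rewrite !mulr_sumr -!big_split; apply: eq_bigr => u _ /=.
by rewrite !mulr_sumr -!big_split; apply: eq_bigr => v _ /=; ring.
Qed.

Lemma energy_affine c d x :
  energy G (fun v => c * (x v + d)) = c ^+ 2 * energy G x.
Proof.
rewrite energyZ; congr (_ * _); congr (_ * _).
by apply: eq_bigr => u _; apply: eq_bigr => v _; congr (_ * _); ring.
Qed.

Lemma energy_form_shift x z d :
  energy_form x (fun v => z v + d) = energy_form x z.
Proof.
congr (_ * _); apply: eq_bigr => u _; apply: eq_bigr => v _.
by congr (_ * (_ * _)); ring.
Qed.

Lemma mass_form_shift x z d : mass_form G x (fun v => z v + d) =
  mass_form G x z + d * mass_form G x (fun=> 1).
Proof. by rewrite /mass_form mulr_sumr -big_split; apply: eq_bigr => v _ /=; ring. Qed.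

Lemma mass_formC x z : mass_form G x z = mass_form G z x.
Proof. by apply: eq_bigr => v _; ring. Qed.

Lemma mass_formDl x y z e : mass_form G (fun v => x v + e * z v) y =
  mass_form G x y + e * mass_form G z y.
Proof. by rewrite /mass_form mulr_sumr -big_split; apply: eq_bigr => v _ /=; ring. Qed.

Lemma mass_formDD x z e :
  mass_form G (fun v => x v + e * z v) (fun v => x v + e * z v) =
  mass_form G x x + 2 * e * mass_form G x z + e ^+ 2 * mass_form G z z.
Proof. by rewrite /mass_form !mulr_sumr -!big_split; apply: eq_bigr => v _ /=; ring. Qed.

Lemma mass1_gt0 : (1 < #|V|)%N -> 0 < mass_form G (fun=> 1) (fun=> 1).
Proof.
move=> /ltnW/card_gt0P[v _]; apply: mass_form_gt0 => /(congr1 (@^~ v))/eqP.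
by rewrite oner_eq0.
Qed.

Lemma lambda2_le y : (1 < #|V|)%N -> mass_form G y (fun=> 1) = 0 ->
  lambda2 G * mass_form G y y <= energy G y.
Proof.
move=> V2 y0; have [x [_ _ -> min_x]] := lambda2_min G V2.
have [->|/eqP yn0] := eqVneq y (fun=> 0).
  have -> : mass_form G (fun=> 0) (fun=> 0) = 0.
    by apply: big1 => v _; rewrite mulr0.
  by rewrite mulr0 energy_ge0.
by rewrite -ler_pdivlMr ?min_x // mass_form_gt0.
Qed.

(** The first variation at a minimiser gives L x = [lambda2] M x in weak form. Adding a constant to
    [z] changes neither side, so [z] may be centred to meet the constraint. *)
Lemma lambda2_eigen : (1 < #|V|)%N ->
  exists x, [/\ mass_form G x (fun=> 1) = 0, x <> (fun=> 0) &
    forall z, energy_form x z = lambda2 G * mass_form G x z].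
Proof.
move=> V2; have [x [x0 xn0 lE _]] := lambda2_min G V2.
have xE : energy G x = lambda2 G * mass_form G x x.
  by rewrite lE divfK // gt_eqF // mass_form_gt0.
exists x; split => // z.
pose d := - mass_form G z (fun=> 1) / mass_form G (fun=> 1) (fun=> 1).
pose w v := z v + d.
have w0 : mass_form G w (fun=> 1) = 0.
  rewrite mass_formC mass_form_shift /d divfK ?gt_eqF ?mass1_gt0 //.
  by rewrite mass_formC subrr.
rewrite -(energy_form_shift x z d) -/w.
have -> : mass_form G x z = mass_form G x w by rewrite mass_form_shift x0 mulr0 addr0.
apply/eqP; rewrite -subr_eq0; apply/eqP.
suff /eqP : 2 * (energy_form x w - lambda2 G * mass_form G x w) = 0.
  by rewrite mulf_eq0 pnatr_eq0 => /eqP.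
apply: (@quadratic_ge0_linear0 _ _ (energy G w - lambda2 G * mass_form G w w)) => e.
have := @lambda2_le (fun v => x v + e * w v) V2.
rewrite mass_formDl x0 w0 mulr0 addr0 => /(_ erefl).
rewrite energyD xE mass_formDD; lra.
Qed.

(** * Layers of a function and their energy *)

(* Rescaling by [t i] the layers of [x] does not need the path itself: on an edge,
   where all the layers increase in the same direction, use Cauchy-Schwarz with
   weights [g i * (h i u - h i v)]. *)
Lemma energy_layers (I : finType) (g t : I -> R) (h : I -> V -> R) x f :
  (forall i, 0 <= g i) ->
  (forall v, x v = \sum_i g i * h i v) ->
  (forall v, f v = \sum_i g i * t i * h i v) ->
  (forall u v, (forall i, h i u <= h i v) \/ (forall i, h i v <= h i u)) ->
  energy G f <= \sum_i g i * t i ^+ 2 * energy_form x (h i).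
Proof.
move=> g0 xE fE chain.
(* Distributing the right side over the edges reduces the claim to a single edge. *)
have -> : \sum_i g i * t i ^+ 2 * energy_form x (h i) =
    2^-1 * \sum_u \sum_(v | edge G u v) cond G u v *
      ((x u - x v) * \sum_i g i * (h i u - h i v) * t i ^+ 2).
  rewrite mulr_sumr.
  under [RHS]eq_bigr => u _.
    rewrite mulr_sumr.
    under eq_bigr => v _ do rewrite !mulr_sumr.
    rewrite exchange_big /=.
  over.
  rewrite exchange_big /=; apply: eq_bigr => i _.
  rewrite /energy_form mulrCA mulr_sumr mulr_sumr; apply: eq_bigr => u _.
  by rewrite !mulr_sumr; apply: eq_bigr => v _; ring.
apply: ler_wpM2l; first by rewrite invr_ge0.
apply: ler_sum => u _; apply: ler_sum => v uv.
apply: ler_wpM2l; first by rewrite ltW // cond_gt0.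
have xB a b : x a - x b = \sum_i g i * (h i a - h i b).
  by rewrite !xE -sumrB; apply: eq_bigr => i _; ring.
have fB a b : f a - f b = \sum_i g i * (h i a - h i b) * t i.
  by rewrite !fE -sumrB; apply: eq_bigr => i _; ring.
have key a b : (forall i, h i b <= h i a) -> (f a - f b) ^+ 2 <=
    (x a - x b) * \sum_i g i * (h i a - h i b) * t i ^+ 2.
  move=> hab; rewrite fB xB; apply: cauchy_schwarz_weighted => i.
  by rewrite mulr_ge0 // subr_ge0.
have [huv|hvu] := chain u v; last exact: key.
have := key _ _ huv.
have -> : \sum_i g i * (h i u - h i v) * t i ^+ 2 =
    - \sum_i g i * (h i v - h i u) * t i ^+ 2.
  by rewrite -sumrN; apply: eq_bigr => i _; ring.
by rewrite -sqrrN opprB -[x u - x v]opprB mulrNN.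
Qed.

(* The layers are indexed by the rank of the positive vertices rather than by the
   values of [x]: ties only produce layers of height [g i = 0].  [rho] is the
   resistance of the path between level 0 and [A], up to the factor lambda2. *)
Lemma positive_layers x v0 : 0 < x v0 ->
  exists p (g t : 'I_p -> R) (S : 'I_p -> {set V}) (A : {set V}) (rho : R),
  [/\ [/\ forall i, 0 <= g i,
          forall v, Num.max (x v) 0 = \sum_i g i * (v \in S i)%:R,
          forall i v, v \in S i -> 0 < x v &
          forall u v, (forall i, u \in S i -> v \in S i) \/
                      (forall i, v \in S i -> u \in S i)],
      A != finset.set0,
      forall v, v \in A ->
        0 < x v /\ \sum_i g i * t i * (v \in S i)%:R = rho,
      \sum_i g i * t i ^+ 2 * (\sum_(v in S i) mass G v * x v) = rho &
      4^-1 <= rho * vmass G A].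
Proof.
move=> xv0.
pose s := sort (fun u v => x u <= x v) (enum [pred v | 0 < x v]).
have s_uniq : uniq s by rewrite sort_uniq enum_uniq.
have mem_s v : (v \in s) = (0 < x v) by rewrite mem_sort mem_enum inE.
have s_sorted : sorted (fun u v => x u <= x v) s.
  by apply: sort_sorted => u v; exact: le_total.
pose p := size s; pose X j := x (nth v0 s j); pose m j := mass G (nth v0 s j).
have p0 : (0 < p)%N by rewrite -has_predT; apply/hasP; exists v0; rewrite ?mem_s.
have X0 : 0 < X 0%N by rewrite /X -mem_s mem_nth.
have Xi i : (i.+1 < p)%N -> X i <= X i.+1.
  by move=> ip; have /(sortedP v0)/(_ i ip) := s_sorted.
have m0 i : 0 < m i by exact: mass_gt0.
have [k kp hk] := hardy_line p0 X0 Xi m0.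
(* The positive vertices of rank at least [i] form a layer of height [gap X i]. *)
pose S (i : nat) := [set v in drop i s].
have memS i v : (v \in S i) = (v \in s) && (i <= index v s)%N.
  rewrite inE; apply/idP/andP => [/(nthP v0)[j]|[vs iv]].
    rewrite size_drop ltn_subRL nth_drop => ij <-.
    by rewrite mem_nth // index_uniq // leq_addr.
  apply/(nthP v0); exists (index v s - i)%N; last by rewrite nth_drop subnKC ?nth_index.
  by rewrite size_drop ltn_sub2r ?(leq_ltn_trans iv) ?index_mem.
have sum_layers (F : nat -> R) v : v \in s ->
    \sum_(i < p) F i * (v \in S i)%:R = \sum_(0 <= i < (index v s).+1) F i.
  move=> vs; rewrite -(big_mkord xpredT (fun i => F i * (v \in S i)%:R)).
  rewrite (big_cat_nat _ (n := (index v s).+1)) //=; last by rewrite index_mem.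
  rewrite [X in _ + X]big_nat_cond [X in _ + X]big1 => [|i].
    rewrite addr0; apply: eq_big_nat => i; rewrite ltnS => /andP[_ iv].
    by rewrite memS vs iv mulr1.
  by rewrite andbT => /andP[vi _]; rewrite memS [(i <= _)%N]leqNgt vi andbF mulr0.
(* Weights 1/U up to rank [k] and 0 beyond stop the potential from growing inside [S k]. Its value
   there and the sum of [g i * t i ^+ 2] times the moments both become [line_res p X m k]. *)
pose t i := if (i <= k)%N then (moment p X m i)^-1 else 0.
exists p, (fun i => gap X i), t, S, (S k), (line_res p X m k).
split; [split| | | |].
- by move=> i; exact: (gap_ge0 X0 Xi).
- move=> v; have [xv|xv] := leP (x v) 0.
    rewrite big1 // => i _; rewrite memS mem_s ltNge xv.
    by rewrite mulr0.
  by rewrite sum_layers ?mem_s // sum_gap /X nth_index ?mem_s.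
- by move=> i v; rewrite memS mem_s => /andP[].
(* The layers are final segments of one ranking, hence nested. *)
- move=> u v; case us : (u \in s); last by left=> i; rewrite memS us.
  case vs : (v \in s); last by right=> i; rewrite memS vs.
  have [uv|/ltnW vu] := leqP (index u s) (index v s); [left|right] => i;
    rewrite !memS us vs /= => h; exact: leq_trans h _.
- by apply/set0Pn; exists (nth v0 s k); rewrite memS mem_nth //= index_uniq.
- move=> v; rewrite memS => /andP[vs kv]; split; first by rewrite -mem_s.
  rewrite (sum_layers (fun i => gap X i * t i)) //.
  rewrite (big_cat_nat _ (n := k.+1)) //= [X in _ + X]big_nat_cond.
  rewrite [X in _ + X]big1 => [|i /andP[/andP[ki _] _]]; last first.
    by rewrite /t leqNgt ki mulr0.
  by rewrite addr0; apply: eq_big_nat => i; rewrite ltnS /t => /andP[_ ->].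
- rewrite -(big_mkord xpredT (fun i => gap X i * t i ^+ 2 *
     (\sum_(v in S i) mass G v * x v))).
  rewrite (big_cat_nat _ (n := k.+1)) //= [X in _ + X]big_nat_cond.
  rewrite [X in _ + X]big1 => [|i /andP[/andP[ki _] _]]; last first.
    by rewrite /t leqNgt ki expr0n mulr0 mul0r.
  rewrite addr0; apply: eq_big_nat => i; rewrite ltnS /t => /andP[_ ik].
  have ip : (i < p)%N by exact: leq_ltn_trans ik kp.
  rewrite ik (sum_set_drop v0) // -/(moment p X m i).
  by field; rewrite gt_eqF // (moment_gt0 X0 Xi m0).
- by rewrite /vmass (sum_set_drop v0).
Qed.

(** * The upper bound *)

Lemma vmass_gt0 (A : {set V}) : A != finset.set0 -> 0 < vmass G A.
Proof.
move=> /set0Pn[v vA]; rewrite /vmass (bigD1 v) //= ltr_pwDl ?mass_gt0 //.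
by apply: sumr_ge0 => w _; rewrite ltW // mass_gt0.
Qed.

Lemma hardy2_gt0 : (1 < #|V|)%N -> connected_graph G -> 0 < hardy2 G.
Proof.
move=> V2 cG; have [[A [B [A0 B0 dAB ->]]] _] := hardy2_max G V2.
by rewrite mulr_gt0 // invr_gt0 ?eff_cond_gt0 // addr_gt0 // invr_gt0 vmass_gt0.
Qed.

Lemma mass_form_ge_disjoint (A B : {set V}) x : (A :&: B)%SET = finset.set0 ->
  \sum_(v in A) mass G v * x v ^+ 2 + \sum_(v in B) mass G v * x v ^+ 2 <=
  mass_form G x x.
Proof.
move=> /eqP; rewrite setI_eq0 => dAB.
have -> : mass_form G x x = \sum_v mass G v * x v ^+ 2.
  by apply: eq_bigr => v _; ring.
rewrite [leRHS](bigID (mem A)) /= lerD2l.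
rewrite big_mkcond [leRHS]big_mkcond; apply: ler_sum => v _ /=.
have ge0 : 0 <= mass G v * x v ^+ 2 by rewrite mulr_ge0 ?sqr_ge0 // ltW // mass_gt0.
by case: ifP => vB; [rewrite (disjointFl dAB vB)|case: ifP].
Qed.

Lemma lambda2_upper : (1 < #|V|)%N -> connected_graph G ->
  lambda2 G <= 1 / hardy2 G.
Proof.
move=> V2 cG; have [[A [B [A0 B0 dAB ->]]] _] := hardy2_max G V2.
have [x [xA xB cE _]] := eff_cond_min G dAB.
have c0 := eff_cond_gt0 cG A0 B0 dAB.
have a0 := vmass_gt0 A0; have b0 := vmass_gt0 B0.
rewrite /eff_res; set a := vmass G A in a0 *; set b := vmass G B in b0 *.
(* Subtracting the mean leaves the values [1 + d] on [A] and [d] on [B]. *)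
pose d := - mass_form G x (fun=> 1) / mass_form G (fun=> 1) (fun=> 1).
pose y v := 1 * (x v + d).
have y0 : mass_form G y (fun=> 1) = 0.
  have -> : y = (fun v => x v + d) by apply/funext => v; rewrite /y mul1r.
  rewrite mass_formC mass_form_shift /d divfK ?gt_eqF ?mass1_gt0 //.
  by rewrite mass_formC subrr.
have := lambda2_le V2 y0; rewrite /y energy_affine expr1n mul1r -cE -/y.
have yy : (1 + d) ^+ 2 * a + d ^+ 2 * b <= mass_form G y y.
  apply: le_trans (mass_form_ge_disjoint y dAB); rewrite /a /b /vmass !mulr_sumr.
  rewrite le_eqVlt; apply/orP; left; apply/eqP; congr (_ + _).
    by apply: eq_bigr => v vA; rewrite /y xA // mul1r mulrC.
  by apply: eq_bigr => v vB; rewrite /y xB // mul1r add0r mulrC.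
(* Multiplied by [a + b], the difference of the two sides is the square of [(1 + d) * a + d * b]. *)
have hm : (a^-1 + b^-1)^-1 <= (1 + d) ^+ 2 * a + d ^+ 2 * b.
  have -> : (a^-1 + b^-1)^-1 = a * b / (a + b).
    by field; rewrite !gt_eqF // addr_gt0.
  rewrite ler_pdivrMr ?addr_gt0 //.
  have := sqr_ge0 ((1 + d) * a + d * b); nra.
have l0 : 0 <= lambda2 G.
  have [z [_ _ -> _]] := lambda2_min G V2.
  rewrite divr_ge0 ?energy_ge0 //; apply: sumr_ge0 => v _.
  by rewrite mulrAC -expr2 mulr_ge0 ?sqr_ge0 // ltW // mass_gt0.
move=> h; have hm0 : 0 < (a^-1 + b^-1)^-1 by rewrite invr_gt0 addr_gt0 ?invr_gt0.
rewrite div1r invfM invrK ler_pdivlMr // (le_trans _ h) // ler_wpM2l //.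
exact: le_trans hm yy.
Qed.

(** * The lower bound *)

(** On a connected graph a minimiser of zero energy would be constant, and mean zero would make it
    vanish. *)
Lemma lambda2_gt0 : (1 < #|V|)%N -> connected_graph G -> 0 < lambda2 G.
Proof.
move=> V2 cG; have [x [x0 xn0 -> _]] := lambda2_min G V2.
rewrite divr_gt0 ?mass_form_gt0 // lt_neqAle energy_ge0 andbT eq_sym.
apply/eqP => /(energy_eq0 cG) xc; apply: xn0; apply/funext => v.
move: x0; have -> : x = (fun=> x v * 1) by apply/funext => u; rewrite mulr1.
have -> : mass_form G (fun=> x v * 1) (fun=> 1) =
    x v * mass_form G (fun=> 1) (fun=> 1).
  by rewrite /mass_form mulr_sumr; apply: eq_bigr => u _; ring.
move=> /eqP; rewrite mulf_eq0 [X in _ || X]gt_eqF ?mass1_gt0 // orbF => /eqP.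
by move=> ->; rewrite mul0r.
Qed.

Lemma mean0_exists_pos x : mass_form G x (fun=> 1) = 0 -> x <> (fun=> 0) ->
  exists v, 0 < x v.
Proof.
move=> x0 xn0; apply: contrapT => npos.
have xle v : x v <= 0 by rewrite leNgt; apply/negP => h; apply: npos; exists v.
apply: xn0; apply/funext => v; apply/eqP.
have : \sum_v - x v * mass G v == 0.
  have -> : \sum_v - x v * mass G v = - mass_form G x (fun=> 1).
    by rewrite -sumrN; apply: eq_bigr => u _; ring.
  by rewrite x0 oppr0.
rewrite psumr_eq0 => [/allP/(_ v (mem_index_enum _))|u _].
  by rewrite /= mulf_eq0 [X in _ || X]gt_eqF ?mass_gt0 // orbF oppr_eq0.
by rewrite mulr_ge0 ?oppr_ge0 // ltW // mass_gt0.
Qed.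

Lemma lambda2_lower : (1 < #|V|)%N -> connected_graph G ->
  1 / (4 * hardy2 G) <= lambda2 G.
Proof.
move=> V2 cG; have l0 := lambda2_gt0 V2 cG.
have [x [x0 xn0 xeig]] := lambda2_eigen V2.
have [v1 xv1] := mean0_exists_pos x0 xn0.
pose x' v := - x v.
have [||v2 xv2] := @mean0_exists_pos x'.
- transitivity (- mass_form G x (fun=> 1)); last by rewrite x0 oppr0.
  by rewrite /mass_form -sumrN; apply: eq_bigr => v _; rewrite /x'; ring.
- move=> E; apply: xn0; apply/funext => v; apply: oppr_inj.
  by rewrite oppr0 -[RHS](congr1 (@^~ v) E).
have [p [g [t [S [A [r [[g0 xE Spos Sc] A0 fA rE rA]]]]]]] := positive_layers xv1.
have [q [g' [t' [S' [B [r' [[g0' xE' Spos' Sc'] B0 fB rE' rB]]]]]]] :=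
  positive_layers xv2.
(* The layers of [- x] enter with a minus sign, so that all the layers together sum to [x]. *)
pose gg (i : 'I_p + 'I_q) := match i with inl i => g i | inr j => g' j end.
pose tt (i : 'I_p + 'I_q) := match i with inl i => t i | inr j => t' j end.
pose h (i : 'I_p + 'I_q) v : R :=
  match i with inl i => (v \in S i)%:R | inr j => - (v \in S' j)%:R end.
pose f v := \sum_i gg i * tt i * h i v.
have fE v : f v = \sum_i g i * t i * (v \in S i)%:R -
                  \sum_i g' i * t' i * (v \in S' i)%:R.
  rewrite /f big_sumType /= -sumrN; congr (_ + _).
  by apply: eq_bigr => j _; rewrite mulrN.
have notS v i : x v <= 0 -> (v \in S i) = false.
  by move=> xv; apply/negP => /Spos; rewrite ltNge xv.
have notS' v i : 0 <= x v -> (v \in S' i) = false.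
  by move=> xv; apply/negP => /Spos'; rewrite /x' oppr_gt0 ltNge xv.
(* Tested against a layer, the eigenvalue equation turns [energy_form] into [lambda2] times the
   moment of that layer. *)
have fle : energy G f <= lambda2 G * (r + r').
  have := @energy_layers _ gg tt h x f; rewrite big_sumType /=.
  have -> : \sum_(i : 'I_p) g i * t i ^+ 2 * energy_form x (h (inl i)) =
      lambda2 G * r.
    rewrite -rE mulr_sumr; apply: eq_bigr => i _.
    rewrite xeig mulrCA; congr (_ * (_ * _)).
    rewrite big_mkcond; apply: eq_bigr => v _ /=.
    by case: ifP => _ /=; ring.
  have -> : \sum_(i : 'I_q) g' i * t' i ^+ 2 * energy_form x (h (inr i)) =
      lambda2 G * r'.
    rewrite -rE' mulr_sumr; apply: eq_bigr => i _.
    rewrite xeig mulrCA; congr (_ * (_ * _)).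
    rewrite big_mkcond; apply: eq_bigr => v _ /=.
    by rewrite /x'; case: ifP => _ /=; ring.
  rewrite -mulrDr; apply => //.
  - by case.
  - move=> v; rewrite big_sumType /=.
    have -> : \sum_i g' i * - (v \in S' i)%:R = - Num.max (x' v) 0.
      by rewrite xE' -sumrN; apply: eq_bigr => j _; rewrite mulrN.
    rewrite -xE /x'; have [xv|xv] := leP (x v) 0.
      by rewrite max_l ?oppr_ge0 // opprK add0r.
    by rewrite max_r ?oppr_le0 ?ltW // subr0.
  (* Vertices on the same side of level 0 are compared by nesting; across level 0 every layer
     increases towards the positive vertex. *)
  - move=> u v; have [xu|xu] := leP (x u) 0; have [xv|xv] := leP (x v) 0.
    + have [c|c] := Sc' u v; [right|left] => -[] i /=; rewrite ?notS //.
        by rewrite lerN2 ler_nat; case E: (u \in _) => //; rewrite c.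
      by rewrite lerN2 ler_nat; case E: (v \in _) => //; rewrite c.
    + left=> -[] i /=; first by rewrite notS ?ler0n.
      by rewrite (notS' v) ?(ltW xv) // oppr0 oppr_le0 ler0n.
    + right=> -[] i /=; first by rewrite (notS v) ?ler0n.
      by rewrite (notS' u) ?(ltW xu) // oppr0 oppr_le0 ler0n.
    + have [c|c] := Sc u v; [left|right] => -[] i /=; rewrite ?notS' ?(ltW xu) ?(ltW xv) //.
        by rewrite ler_nat; case E: (u \in _) => //; rewrite c.
      by rewrite ler_nat; case E: (v \in _) => //; rewrite c.
have fAr v : v \in A -> f v = r.
  move=> /fA[xv E]; rewrite fE E big1 ?subr0 // => i _.
  by rewrite notS' ?mulr0 // ltW.
have fBr v : v \in B -> f v = - r'.
  move=> /fB[]; rewrite /x' oppr_gt0 => xv E; rewrite fE E big1 ?sub0r // => i _.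
  by rewrite notS ?mulr0 // ltW.
have a0 := vmass_gt0 A0; have b0 := vmass_gt0 B0.
have rpos : 0 < r by rewrite -(pmulr_lgt0 _ a0) (lt_le_trans _ rA) // invr_gt0.
have r'pos : 0 < r' by rewrite -(pmulr_lgt0 _ b0) (lt_le_trans _ rB) // invr_gt0.
have dAB : (A :&: B)%SET = finset.set0.
  apply/eqP/set0Pn => -[v]; rewrite inE => /andP[/fA[xv _] /fB[]].
  by rewrite /x' oppr_gt0 ltNge ltW.
(* The potential is [r] on [A] and [- r'] on [B]; this rescaling to 1 and 0 divides the energy by
   [(r + r') ^+ 2]. *)
pose y v := (r + r')^-1 * (f v + r').
have rr : r + r' != 0 by rewrite gt_eqF ?addr_gt0.
have cle : eff_cond G A B <= lambda2 G / (r + r').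
  have [z [_ _ -> zmin]] := eff_cond_min G dAB.
  apply: le_trans (zmin y _ _) _.
  - by move=> v vA; rewrite /y fAr // mulVf.
  - by move=> v vB; rewrite /y fBr // addNr mulr0.
  rewrite /y energy_affine exprVn mulrC ler_pdivrMr ?exprn_gt0 ?addr_gt0 //.
  by apply: le_trans fle _; rewrite expr2 mulrA divfK.
have [_ /(_ A B A0 B0 dAB) Hle] := hardy2_max G V2.
have c0 := eff_cond_gt0 cG A0 B0 dAB.
have H0 := hardy2_gt0 V2 cG.
rewrite ler_pdivrMr ?mulr_gt0 //.
suff : 4^-1 <= lambda2 G * hardy2 G by lra.
apply: le_trans (ler_wpM2l (ltW l0) Hle).
set a := vmass G A in a0 rA *; set b := vmass G B in b0 rB *.
have hm0 : 0 < a^-1 + b^-1 by rewrite addr_gt0 ?invr_gt0.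
rewrite mulrA ler_pdivlMr // /eff_res ler_pdivlMr //.
(* The two Hardy bounds read [4^-1 / a <= r] and [4^-1 / b <= r']. *)
have e1 : 4^-1 * (a^-1 + b^-1) <= r + r'.
  by rewrite mulrDr lerD // ler_pdivrMr.
apply: le_trans (ler_wpM2r (ltW c0) e1) _.
by rewrite mulrC -ler_pdivlMr ?addr_gt0.
Qed.

End Graph.

Theorem theorem6 (R : realType) (V : finType) (G : wgraph R V) :
  (1 < #|V|)%N -> connected_graph G ->
  1 / (4 * hardy2 G) <= lambda2 G /\ lambda2 G <= 1 / hardy2 G.
Proof.
by move=> V2 cG; split; [exact: lambda2_lower|exact: lambda2_upper].
Qed.
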